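(* Let $A$ be a real Cayley--Dickson algebra with anisotropic norm form and $\dim_{\mathbb{R}} A\geq 16$. Then $A$ is not algebraically closed: there exist $\alpha,\beta\in A$ with $\alpha\neq 0$ such that the linear polynomial $f(x)=\alpha x-\beta\in A[x]$ has no root in $A$.
   Context: Algebras are unital but not necessarily commutative or associative. Given an $F$-algebra $A$ with involution $q\mapsto\overline{q}$ and $\gamma\in F^\times$, its Cayley--Dickson double is $A\{\gamma\}=A\oplus A\ell$ with product $(q+r\ell)(s+t\ell)=qs+\gamma\overline{t}r+(tq+r\overline{s})\ell$ for $q,r,s,t\in A$, and involution $\overline{q+r\ell}=\overline{q}-r\ell$. A Cayley--Dickson algebra over $F$ is an algebra obtained by repeating this doubling several times, starting with a quadratic separable extension $K$ of $F$ with its non-trivial $F$-automorphism as the involution. Its norm form is the quadratic form $\operatorname{Norm}(q)=q\cdot\overline{q}\in F$. The real Cayley--Dickson algebras with anisotropic norm form are the algebras $\mathbb{R}\{-1,-1,\dots,-1\}$ (up to isomorphism), obtained from $\mathbb{R}$ (with trivial involution) by repeated doubling with $\gamma=-1$; the first ones are $\mathbb{C},\mathbb{H},\mathbb{O},\mathbb{S}$ of dimensions $2,4,8,16$. $A[x]=A\otimes_F F[x]$ with $x$ central, and for $f(x)=c_nx^n+\dots+c_1x+c_0$ and $\lambda\in A$ one sets $f(\lambda)=c_n(\lambda^n)+\dots+c_1\lambda+c_0$; $\lambda$ is a root of $f(x)$ if $f(\lambda)=0$. ''Algebraically closed'' means that every polynomial in $A[x]$ of degree at least $1$ has a root in $A$.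 *)

(* Defs.v *)
From HB Require Import structures.
From mathcomp Require Import all_boot all_order all_algebra all_field reals.
From mathcomp Require Import finmap monalg.

Set Implicit Arguments.
Unset Strict Implicit.
Unset Printing Implicit Defensive.

Import Order.TTheory GRing.Theory Num.Theory.
Local Open Scope ring_scope.

(* Finite-dimensional unital F-algebras with involution; the product is not
   assumed commutative or associative, so this is not one of MathComp's ring
   structures. *)
Record invAlg (F : fieldType) := InvAlg {
  acarrier :> vectType F;
  amul : acarrier -> acarrier -> acarrier;
  aone : acarrier;
  aconj : acarrier -> acarrier;
  amul_linearl : forall y, linear (amul ^~ y);
  amul_linearr : forall x, linear (amul x);
  amul1l : left_id aone amul;
  amul1r : right_id aone amul;
  aconj_linear : linear aconj;
  aconjK : involutive aconj;
  aconjM : forall x y, aconj (amul x y) = amul (aconj y) (aconj x)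
}.

Declare Scope invalg_scope.
Delimit Scope invalg_scope with ia.
Notation "x ** y" := (amul x y)
  (at level 40, left associativity) : invalg_scope.
Local Open Scope invalg_scope.

Arguments aone {F i}.

Section InvAlgTheory.
Variables (F : fieldType) (A : invAlg F).
Implicit Types (x y z : A) (a : F).

Lemma amulDl x y z : (x + y) ** z = x ** z + y ** z.
Proof. by have := amul_linearl z 1 x y; rewrite !scale1r. Qed.
Lemma amulDr x y z : x ** (y + z) = x ** y + x ** z.
Proof. by have := amul_linearr x 1 y z; rewrite !scale1r. Qed.
Lemma amul0l x : 0 ** x = 0.
Proof. by apply: (addrI (0 ** x)); rewrite -amulDl !addr0. Qed.
Lemma amul0r x : x ** 0 = 0.
Proof. by apply: (addrI (x ** 0)); rewrite -amulDr !addr0. Qed.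
Lemma amulZl a x y : (a *: x) ** y = a *: (x ** y).
Proof. by have := amul_linearl y a x 0; rewrite amul0l !addr0. Qed.
Lemma amulZr a x y : x ** (a *: y) = a *: (x ** y).
Proof. by have := amul_linearr x a y 0; rewrite amul0r !addr0. Qed.
Lemma amulNl x y : (- x) ** y = - (x ** y).
Proof. by rewrite -scaleN1r amulZl scaleN1r. Qed.
Lemma amulNr x y : x ** (- y) = - (x ** y).
Proof. by rewrite -scaleN1r amulZr scaleN1r. Qed.
Lemma aconjD x y : aconj (x + y) = aconj x + aconj y.
Proof. by have := aconj_linear 1 x y; rewrite !scale1r. Qed.
Lemma aconj0 : aconj (0 : A) = 0.
Proof. by apply: (addrI (aconj 0)); rewrite -aconjD !addr0. Qed.
Lemma aconjZ a x : aconj (a *: x) = a *: aconj x.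
Proof. by have := aconj_linear a x 0; rewrite aconj0 !addr0. Qed.
Lemma aconjN x : aconj (- x) = - aconj x.
Proof. by rewrite -scaleN1r aconjZ scaleN1r. Qed.
Lemma aconj1 : aconj (aone : A) = aone.
Proof.
by rewrite -[LHS]amul1l -{1}[aone]aconjK -aconjM amul1l aconjK.
Qed.

End InvAlgTheory.

Section Double.
Variables (F : fieldType) (A : invAlg F) (gamma : F).

(* The pair (q, r) stands for q + r l. *)
Definition dbl_mul (u v : A * A) : A * A :=
  (u.1 ** v.1 + gamma *: (aconj v.2 ** u.2), v.2 ** u.1 + u.2 ** aconj v.1).
Definition dbl_conj (u : A * A) : A * A := (aconj u.1, - u.2).
Definition dbl_one : A * A := (aone, 0).

Lemma dbl_linearl v : linear (dbl_mul ^~ v).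
Proof.
move=> a [q r] [s t]; congr pair => /=.
  rewrite amulDl amulDr amulZl amulZr !scalerDr !scalerA (mulrC gamma).
  exact: addrACA.
by rewrite amulDr amulDl amulZl amulZr scalerDr addrACA.
Qed.
Lemma dbl_linearr u : linear (dbl_mul u).
Proof.
move=> a [q r] [s t]; congr pair => /=.
  rewrite amulDr amulZr aconjD aconjZ amulDl amulZl !scalerDr !scalerA.
  by rewrite (mulrC gamma) addrACA.
by rewrite aconjD aconjZ amulDr amulDl amulZl amulZr scalerDr addrACA.
Qed.
Lemma dbl_mul1l : left_id dbl_one dbl_mul.
Proof.
case=> q r; congr pair => /=; first by rewrite amul1l amul0r scaler0 addr0.
by rewrite amul1r amul0l addr0.
Qed.
Lemma dbl_mul1r : right_id dbl_one dbl_mul.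
Proof.
case=> q r; congr pair => /=.
  by rewrite amul1r aconj0 amul0l scaler0 addr0.
by rewrite aconj1 amul1r amul0l add0r.
Qed.
Lemma dbl_conj_linear : linear dbl_conj.
Proof.
move=> a [q r] [s t]; congr pair => /=; first by rewrite aconjD aconjZ.
by rewrite opprD scalerN.
Qed.
Lemma dbl_conjK : involutive dbl_conj.
Proof. by case=> q r; rewrite /dbl_conj /= aconjK opprK. Qed.
Lemma dbl_conjM u v :
  dbl_conj (dbl_mul u v) = dbl_mul (dbl_conj v) (dbl_conj u).
Proof.
case: u v => [q r] [s t]; congr pair => /=.
  by rewrite aconjD aconjZ !aconjM !aconjK aconjN amulNl amulNr opprK.
by rewrite aconjK !amulNl addrC opprD.
Qed.

Definition cd_double : invAlg F :=
  @InvAlg F (A * A)%type dbl_mul dbl_one dbl_conj dbl_linearl dbl_linearr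
    dbl_mul1l dbl_mul1r dbl_conj_linear dbl_conjK dbl_conjM.

End Double.

Section FieldWithInvolution.
Variables (F : fieldType) (K : fieldExtType F) (sigma : {lrmorphism K -> K}).
Hypothesis sigmaK : involutive sigma.

Fact fld_linearl (y : K) : linear ( *%R^~ y).
Proof. by move=> a u v; rewrite mulrDl scalerAl. Qed.
Fact fld_linearr (x : K) : linear ( *%R x).
Proof. by move=> a u v; rewrite mulrDr scalerAr. Qed.
Fact fld_conjM (x y : K) : sigma (x * y) = sigma y * sigma x.
Proof. by rewrite rmorphM mulrC. Qed.

Definition fld_invAlg : invAlg F :=
  @InvAlg F K *%R 1 sigma fld_linearl fld_linearr (@mul1r K) (@mulr1 K)
    (fun a u v => linearP sigma a u v) sigmaK fld_conjM.

End FieldWithInvolution.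

Record is_iso (F : fieldType) (A B : invAlg F) (f : A -> B) : Prop := IsIso {
  iso_linear : linear f;
  iso_bij : bijective f;
  iso1 : f aone = aone;
  isoM : forall x y, f (x ** y) = f x ** f y;
  isoJ : forall x, f (aconj x) = aconj (f x)
}.

(* "Obtained by repeated doubling" is understood up to isomorphism.
   The non-trivial F-automorphism of a quadratic extension is automatically
   involutive; the hypothesis sigmaK only provides the involution axiom. *)
Inductive cayley_dickson (F : fieldType) : invAlg F -> Prop :=
| CD_quadratic (K : fieldExtType F) (sigma : {lrmorphism K -> K})
    (sigmaK : involutive sigma) :
    \dim {:K} = 2 -> separable 1 {:K} -> ~ (sigma =1 id) ->
    cayley_dickson (fld_invAlg sigmaK)
| CD_double (A : invAlg F) (gamma : F) :
    gamma != 0 -> cayley_dickson A -> cayley_dickson (cd_double A gamma)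
| CD_iso (A B : invAlg F) (f : A -> B) :
    is_iso f -> cayley_dickson A -> cayley_dickson B.

(* The scalar c such that q ** aconj q = c *: aone: lemma normE shows that it
   exists in a Cayley-Dickson algebra. *)
Definition norm (F : fieldType) (A : invAlg F) (q : A) : F :=
  coord [tuple (aone : A)] ord0 (q ** aconj q).

Definition anisotropic (F : fieldType) (A : invAlg F) :=
  forall q : A, norm q = 0 -> q = 0.

Lemma normE (F : fieldType) (A : invAlg F) (q : A) :
  cayley_dickson A -> q ** aconj q = norm q *: aone.
Proof.
move=> cdA.
suff [_ /(_ q) qq]: (aone : A) != 0 /\
    forall q : A, q ** aconj q \in <[aone : A]>%VS.
  have := @coord_span _ _ _ [tuple (aone : A)] (q ** aconj q).
  by rewrite span_seq1 => /(_ qq); rewrite big_ord1 /= => {1}->.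
elim: cdA {q} => {A}.
- move=> K sigma sigmaK dimK sepK sigma_nt /=; split=> [|q]; first exact: oner_neq0.
  pose y := q * sigma q; rewrite -/y.
  have sy : sigma y = y.
    by rewrite /y rmorphM mulrC; congr (_ * _); exact: sigmaK.
  apply: contra_notT sigma_nt => yF x.
  have fr: free [:: y; (1 : K)%R].
    by rewrite free_cons span_seq1 yF seq1_free oner_neq0.
  have: x \in <<[:: y; (1 : K)%R]>>%VS.
    suff /eqP->: (<<[:: y; (1 : K)%R]>> == fullv)%VS by exact: memvf.
    by rewrite eqEdim subvf dimK (eqP fr).
  rewrite span_cons span_seq1 => /memv_addP[_ /vlineP[a ->]] [_ /vlineP[b ->]].
  by move=> ->; rewrite linearD !linearZ /= sy rmorph1.
- move=> A gamma _ _ [nz1 IH]; split=> [|[q r]].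
    by apply: contra_neq nz1 => -[].
  have /vlineP[a qE] := IH q; have /vlineP[b] := IH (aconj r).
  rewrite aconjK => rE; apply/vlineP; exists (a - gamma * b).
  congr pair => /=.
    by rewrite aconjN amulNl qE rE scalerN scalerBl scalerA.
  by rewrite aconjK amulNl addNr scaler0.
- move=> A B f [flin [g fg gf] f1 fM fJ] _ [nz1 IH].
  have f0 : f 0 = 0.
    by have := flin (-1) 0 0; rewrite scaler0 addr0 scaleN1r addNr.
  split=> [|q].
    by rewrite -f1 -f0 (inj_eq (can_inj fg)).
  have /vlineP[a E] := IH (g q); apply/vlineP; exists a.
  have := congr1 f E; rewrite fM fJ gf => ->.
  by have := flin a aone 0; rewrite !addr0 f0 addr0 f1.
Qed.

(* Cayley-Dickson algebras are power-associative, so the choice of bracketing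
   is immaterial. *)
Definition apow (F : fieldType) (A : invAlg F) (q : A) (n : nat) : A :=
  iter n (amul q) aone.

(* A[x], as the additive group of finitely supported coefficient families;
   << a *g n >> is the monomial a x^n and f@_n the coefficient of x^n. *)
Definition apoly (F : fieldType) (A : invAlg F) := {malg A[nat]}.

Definition apdeg (F : fieldType) (A : invAlg F) (f : apoly A) : nat :=
  \max_(i <- msupp f) i.

Definition apeval (F : fieldType) (A : invAlg F) (f : apoly A) (q : A) : A :=
  \sum_(i <- msupp f) f@_i ** apow q i.

Definition aproot (F : fieldType) (A : invAlg F) (f : apoly A) (q : A) :=
  apeval f q = 0.

Definition algebraically_closed (F : fieldType) (A : invAlg F) :=
  forall f : apoly A, (0 < apdeg f)%N -> exists q : A, aproot f q.

(* Main.v *)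
(** Anisotropy of the norm forces the parameter [gamma] of every doubling to be
    negative, so the adjoined element can be rescaled to have square [-1].
    Climbing up the doublings one finds [i] with [i^2 = -1], then a quaternionic
    pair [i, j], and from dimension 16 on the sedenion zero divisor
    [(i + j l) (- (j i) m + m l) = 0], where [m] and [l] are the elements
    adjoined by the third and fourth doublings of the reals.  If [alpha y = 0]
    with [alpha] and [y] nonzero, then left multiplication by [alpha] is not
    injective, hence by finite dimension not surjective, and [alpha x - beta]
    has no root for any [beta] outside its image. *)
From HB Require Import structures.
Require Import Defs.
From mathcomp Require Import all_boot all_order all_algebra all_field reals boolp.
From mathcomp Require Import finmap monalg.
From mathcomp Require Import zify.

Set Implicit Arguments.
Unset Strict Implicit.
Unset Printing Implicit Defensive.

Import Order.TTheory GRing.Theory Num.Theory.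
Local Open Scope ring_scope.
Local Open Scope invalg_scope.

(** * Linear consequences of an isomorphism *)

Section Isomorphism.
Variables (F : fieldType) (A B : invAlg F) (f : A -> B).
Hypothesis isof : is_iso f.

Lemma iso_morph :
  [/\ f 0 = 0, forall x, f (- x) = - f x & forall a x, f (a *: x) = a *: f x].
Proof.
have lf := iso_linear isof.
have f0 : f 0 = 0 by have := lf (-1) 0 0; rewrite scaler0 addr0 scaleN1r addNr.
have fZ a x : f (a *: x) = a *: f x by have := lf a x 0; rewrite !addr0 f0 addr0.
by split=> // x; rewrite -scaleN1r fZ scaleN1r.
Qed.

Lemma iso_eq0 x : (f x == 0) = (x == 0).
Proof.
have [f0 _ _] := iso_morph; have [g fK _] := iso_bij isof.
by rewrite -{1}f0 (inj_eq (can_inj fK)).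
Qed.

Lemma dim_iso : \dim {:A} = \dim {:B}.
Proof.
have [g fK gK] := iso_bij isof.
pose h : {linear A -> B} :=
  HB.pack f (GRing.isLinear.Build F A B *:%R f (iso_linear isof)).
have hE x : linfun h x = f x by rewrite lfunE.
have ker0 : lker (linfun h) = 0%VS.
  apply/eqP; rewrite -subv0; apply/subvP=> x.
  by rewrite memv_ker hE iso_eq0 => /eqP->; exact: mem0v.
have imT : limg (linfun h) = fullv.
  apply/eqP; rewrite eqEsubv subvf; apply/subvP=> y _.
  by rewrite -(gK y) -hE memv_img ?memvf.
by rewrite -(limg_ker_dim (linfun h) fullv) capfv ker0 dimv0 add0n imT.
Qed.

End Isomorphism.

(** * Norm, anisotropy and dimension under doubling *)

Section Norm.
Variable F : fieldType.

(** [invAlg] admits the zero algebra, so nontriviality is carried through the construction. *)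
Lemma cayley_dickson_aone_neq0 (A : invAlg F) :
  cayley_dickson A -> (aone : A) != 0.
Proof.
elim=> {A} [K sigma sigmaK _ _ _|A gamma _ _ nz1|A B f isof _ nz1].
- exact: oner_neq0.
- by apply: contra_neq nz1 => -[].
- by rewrite -(iso1 isof) (iso_eq0 isof).
Qed.

(** As [aone] is nonzero, the scalar is unique; a norm can thus be read off from an explicit product
    instead of from [coord]. *)
Lemma norm_eq (A : invAlg F) (q : A) (c : F) :
  cayley_dickson A -> q ** aconj q = c *: aone -> norm q = c.
Proof.
move=> cdA; rewrite (normE q cdA); move/eqP; rewrite -subr_eq0 -scalerBl.
by rewrite scaler_eq0 (negPf (cayley_dickson_aone_neq0 cdA)) orbF subr_eq0 => /eqP.
Qed.

(** The embedding [q] to [(q, 0)] preserves the norm. *)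
Lemma anisotropic_double (A : invAlg F) (gamma : F) :
    gamma != 0 -> cayley_dickson A ->
  anisotropic (cd_double A gamma) -> anisotropic A.
Proof.
move=> gamma0 cdA aniD q q0.
suff [] : ((q, 0) : cd_double A gamma) = 0 by [].
apply/aniD/norm_eq; first exact: CD_double.
rewrite scale0r; congr pair => /=.
  by rewrite oppr0 amul0r scaler0 addr0 (normE q cdA) q0 scale0r.
by rewrite oppr0 !amul0l addr0.
Qed.

Lemma anisotropic_iso (A B : invAlg F) (f : A -> B) :
  is_iso f -> cayley_dickson A -> anisotropic B -> anisotropic A.
Proof.
move=> isof cdA aniB q q0; have [f0 _ _] := iso_morph isof.
apply/eqP; rewrite -(iso_eq0 isof); apply/eqP/aniB/norm_eq.
  exact: CD_iso isof cdA.
by rewrite -(isoJ isof) -(isoM isof) (normE q cdA) q0 !scale0r.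
Qed.

Lemma dim_double (A : invAlg F) (gamma : F) :
  \dim {:cd_double A gamma} = (\dim {:A} + \dim {:A})%N.
Proof. by rewrite !dimvf. Qed.

End Norm.

(** * Special elements produced by successive doublings *)

Section Units.
Variables (F : fieldType).

Definition has_imaginary_unit (A : invAlg F) :=
  exists i : A, aconj i = - i /\ i ** i = - aone.

(** In the quaternions these products follow from [i^2 = j^2 = -1] and [i j = - j i]; their
    bracketing is the one met when the sedenion quadruple is checked. *)
Definition has_quaternion_pair (A : invAlg F) :=
  exists i j : A, [/\ aconj i = - i, aconj j = - j, i != 0,
    j ** i ** i = - j & j ** i ** j = i].

(* The equations say exactly that [(a + b l) (c + d l) = 0] when [l^2 = -1]. *)
Definition has_sedenion_quadruple (A : invAlg F) :=
  exists a b c d : A,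
    [/\ (a != 0) && (d != 0), aconj c = - c, aconj d = - d,
        a ** c = - (d ** b) & d ** a = b ** c].

Definition has_zero_divisor (A : invAlg F) :=
  exists x y : A, [/\ x != 0, y != 0 & x ** y = 0].

Variables (A : invAlg F) (s : F).
Hypothesis s0 : s != 0.
(** Here [l^2 = - s^2], so [s^-1 l] has square [-1]; this explains the factors [s^-1] in the
    witnesses below. *)
Let D := cd_double A (- s ^+ 2).

Let sV : s ^+ 2 * s^-1 * s^-1 = 1.
Proof. by rewrite -mulrA -expr2 -exprMn divff // expr1n. Qed.

Lemma imaginary_unit_double (gamma : F) :
  has_imaginary_unit A -> has_imaginary_unit (cd_double A gamma).
Proof.
move=> [i [iJ ii]]; exists (i, 0); split; congr pair => //=.
- by rewrite aconj0 amul0l scaler0 addr0.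
- by rewrite !amul0l addr0 oppr0.
Qed.

Lemma quaternion_pair_double :
  (aone : A) != 0 -> has_imaginary_unit A -> has_quaternion_pair D.
Proof.
move=> nz1 [i [iJ ii]].
have i0 : i != 0.
  by apply: contra_neq nz1 => i0; rewrite -[aone]opprK -ii i0 amul0l oppr0.
have ji : ((0, s^-1 *: aone) : D) ** (i, 0) = (0, - (s^-1 *: i)).
  congr pair => /=; first by rewrite amul0l aconj0 amul0l scaler0 addr0.
  by rewrite amul0l add0r iJ amulNr amulZl amul1l.
exists (i, 0), (0, s^-1 *: aone); split.
- by congr pair; rewrite /= ?oppr0.
- by congr pair; rewrite /= ?aconj0 ?oppr0.
- by apply: contra_neq i0 => -[].
- rewrite ji; congr pair => /=.
    by rewrite amul0l aconj0 amul0l scaler0 addr0 oppr0.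
  by rewrite amul0l add0r iJ amulNl amulNr opprK amulZl ii scalerN.
- rewrite ji; congr pair => /=.
    rewrite amul0l add0r aconjZ aconj1 amulNr amulZl amul1l scalerN scaleNr opprK.
    by rewrite !scalerA sV scale1r.
  by rewrite amul0r aconj0 amul0r addr0.
Qed.

Lemma sedenion_quadruple_double :
  (aone : A) != 0 -> has_quaternion_pair A -> has_sedenion_quadruple D.
Proof.
move=> nz1 [i [j [iJ jJ i0 jii jij]]].
(* With [m = (0, aone)] these are [i], [j], [- (j i) m] and [m]. No required product involves two
   multiples of [m], so [m] needs no rescaling. *)
exists (i, 0), (j, 0), (0, - (j ** i)), (0, aone); split.
- apply/andP; split; first by apply: contra_neq i0 => -[].
  by apply: contra_neq nz1 => -[].
- by congr pair; rewrite /= ?aconj0 ?oppr0.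
- by congr pair; rewrite /= ?aconj0 ?oppr0.
- congr pair => /=.
    by rewrite !(amul0l, amul0r, aconj0, scaler0, addr0, oppr0).
  by rewrite !(amul0l, amul0r, addr0, add0r) amulNl jii jJ amul1l.
- congr pair => /=.
    by rewrite !(amul0l, amul0r, aconj0, scaler0, addr0).
  by rewrite !(amul0l, amul0r, aconj0, addr0, add0r) iJ amul1l amulNl jij.
Qed.

Lemma zero_divisor_double : has_sedenion_quadruple A -> has_zero_divisor D.
Proof.
move=> [a [b [c [d [/andP[a0 d0] cJ dJ ac da]]]]].
exists (a, s^-1 *: b), (c, s^-1 *: d); split.
- by apply: contra_neq a0 => -[].
- apply: contra_neq d0 => -[_] /eqP.
  by rewrite scaler_eq0 invr_eq0 (negPf s0) => /eqP.
- congr pair => /=.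
    rewrite aconjZ dJ scalerN amulNl amulZl amulZr scalerN scaleNr opprK.
    by rewrite !scalerA mulrA sV scale1r ac addNr.
  by rewrite cJ amulNr !amulZl da addrN.
Qed.

End Units.

(** * Transport of the special elements along isomorphisms *)

Section UnitsIso.
Variables (F : fieldType) (A B : invAlg F) (f : A -> B).
Hypothesis isof : is_iso f.

Lemma imaginary_unit_iso : has_imaginary_unit A -> has_imaginary_unit B.
Proof.
have [_ fN _] := iso_morph isof; move=> [i [iJ ii]]; exists (f i).
by rewrite -(isoJ isof) -(isoM isof) iJ ii !fN (iso1 isof).
Qed.

Lemma quaternion_pair_iso : has_quaternion_pair A -> has_quaternion_pair B.
Proof.
have [_ fN _] := iso_morph isof; move=> [i [j [iJ jJ i0 jii jij]]].
exists (f i), (f j).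
by rewrite -!(isoJ isof) -!(isoM isof) iJ jJ jii jij !fN (iso_eq0 isof).
Qed.

Lemma sedenion_quadruple_iso :
  has_sedenion_quadruple A -> has_sedenion_quadruple B.
Proof.
have [_ fN _] := iso_morph isof; move=> [a [b [c [d [ad cJ dJ ac da]]]]].
exists (f a), (f b), (f c), (f d).
by rewrite -!(isoJ isof) -!(isoM isof) cJ dJ ac da !fN !(iso_eq0 isof).
Qed.

Lemma zero_divisor_iso : has_zero_divisor A -> has_zero_divisor B.
Proof.
have [f0 _ _] := iso_morph isof; move=> [x [y [x0 y0 xy]]].
by exists (f x), (f y); rewrite -(isoM isof) xy f0 !(iso_eq0 isof).
Qed.

End UnitsIso.

(** * Induction over the real Cayley-Dickson algebras *)

Section Real.
Variable R : realType.

(** The norm of [q + r l] is that of [q] minus [gamma] times that of [r]. For [gamma >= 0] it would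
    vanish at [sqrt gamma + l]. *)
Lemma anisotropic_double_param (A : invAlg R) (gamma : R) :
    gamma != 0 -> cayley_dickson A -> anisotropic (cd_double A gamma) ->
  exists2 s : R, s != 0 & gamma = - s ^+ 2.
Proof.
move=> gamma0 cdA aniD; have nz1 := cayley_dickson_aone_neq0 cdA.
have [gamma_lt0|gamma_ge0] := ltP gamma 0.
  exists (Num.sqrt (- gamma)); first by rewrite sqrtr_eq0 -ltNge oppr_gt0.
  by rewrite sqr_sqrtr ?opprK // oppr_ge0 ltW.
suff [_ one0] : ((Num.sqrt gamma *: aone, aone) : cd_double A gamma) = 0.
  by rewrite one0 eqxx in nz1.
apply/aniD/norm_eq; first exact: CD_double.
rewrite scale0r; congr pair => /=.
  rewrite aconjN aconjZ !aconj1 amulNl amulZl amulZr !amul1l scalerA -expr2.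
  by rewrite sqr_sqrtr // scalerN addrN.
by rewrite aconjK amulNl !amul1l addNr.
Qed.

Lemma fld_imaginary_unit (K : fieldExtType R) (sigma : {lrmorphism K -> K})
    (sigmaK : involutive sigma) :
    cayley_dickson (fld_invAlg sigmaK) -> ~ (sigma =1 id) ->
  has_imaginary_unit (fld_invAlg sigmaK).
Proof.
move=> cdK sigma_nt.
have /existsNP[x /eqP x_moved] := sigma_nt.
(* A nonzero element of the [-1] eigenspace of [sigma]; its square is the scalar [- n]. *)
pose y : K := sigma x - x.
have sy : sigma y = - y.
  by rewrite rmorphB opprB; congr (_ - _); exact: sigmaK.
have y0 : y != 0 by rewrite subr_eq0.
pose n := norm (y : fld_invAlg sigmaK).
have yy : y * y = - (n%:A).
  by have /= := normE (y : fld_invAlg sigmaK) cdK; rewrite sy mulrN => <-; rewrite opprK.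
(* Otherwise [y] is a square root in [K] of the real square [- n], hence a real scalar fixed by
   [sigma], while [sigma y = - y] differs from [y]. *)
have n_gt0 : 0 < n.
  rewrite ltNge; apply/negP => n_le0; pose c := Num.sqrt (- n).
  have cc : - n = c ^+ 2 by rewrite sqr_sqrtr // oppr_ge0.
  have : y ^+ 2 == (c%:A : K) ^+ 2.
    by rewrite expr2 yy -scaleNr cc exprZn expr1n.
  have fixed : sigma y != y.
    rewrite sy eq_sym -subr_eq0 opprK -mulr2n -scaler_nat scaler_eq0 negb_or.
    by rewrite pnatr_eq0 y0.
  rewrite eqf_sqr => /orP[] /eqP yE; move: fixed; rewrite yE ?rmorphN /=.
    by rewrite linearZ /= rmorph1 eqxx.
  by rewrite linearZ /= rmorph1 eqxx.
pose t := (Num.sqrt n)^-1.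
exists (t *: y); split; first by rewrite /= linearZ /= sy scalerN.
rewrite /= -scalerAl -scalerAr yy scalerN scalerN !scalerA.
rewrite -expr2 /t exprVn sqr_sqrtr ?ltW // mulVf ?scale1r //.
by rewrite gt_eqF.
Qed.

(** One joint induction: each of the last three properties of a double comes from the preceding
    property of its half, whose dimension bound is half as large. In dimension 2 only the first
    claim is not vacuous. *)
Lemma cayley_dickson_units (A : invAlg R) :
    cayley_dickson A -> anisotropic A ->
  [/\ has_imaginary_unit A,
      (4 <= \dim {:A})%N -> has_quaternion_pair A,
      (8 <= \dim {:A})%N -> has_sedenion_quadruple A &
      (16 <= \dim {:A})%N -> has_zero_divisor A].
Proof.
elim=> {A} [K sigma sigmaK dimK sepK sigma_nt _|A gamma gamma0 cdA IH aniD|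
            A B f isof cdA IH aniB].
- rewrite dimK; split=> //; apply: fld_imaginary_unit => //.
  exact: CD_quadratic.
- have [hi hq hs _] := IH (anisotropic_double gamma0 cdA aniD).
  have [s s0 ->] := anisotropic_double_param gamma0 cdA aniD.
  have nz1 := cayley_dickson_aone_neq0 cdA.
  rewrite dim_double; split=> [|_|dimA|dimA].
  + exact: imaginary_unit_double.
  + exact: quaternion_pair_double.
  + by apply: sedenion_quadruple_double => //; apply: hq; lia.
  + by apply: (zero_divisor_double s0); apply: hs; lia.
- have [hi hq hs hz] := IH (anisotropic_iso isof cdA aniB).
  rewrite -(dim_iso isof); split.
  + exact: imaginary_unit_iso isof hi.
  + by move=> /hq; exact: quaternion_pair_iso isof.
  + by move=> /hs; exact: sedenion_quadruple_iso isof.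
  + by move=> /hz; exact: zero_divisor_iso isof.
Qed.

End Real.

(** * From a zero divisor to a linear polynomial without roots *)

Lemma zero_divisor_not_surjective (F : fieldType) (A : invAlg F) (x y : A) :
  y != 0 -> x ** y = 0 -> exists b : A, forall z, x ** z != b.
Proof.
move=> y0 xy.
pose h : {linear A -> A} :=
  HB.pack (amul x) (GRing.isLinear.Build F A A *:%R (amul x) (amul_linearr x)).
have hE z : linfun h z = x ** z by rewrite lfunE.
have [imT|/subvPn[b _ nb]] := boolP (fullv <= limg (linfun h))%VS; last first.
  by exists b => z; apply: contraNneq nb => <-; rewrite -hE memv_img ?memvf.
(* If the image were everything, rank-nullity would make the kernel zero, but it contains [y]. *)
have := limg_ker_dim (linfun h) fullv.
rewrite (_ : limg _ = fullv); last by apply/eqP; rewrite eqEsubv subvf.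
move/eqP; rewrite -{2}[\dim fullv]add0n eqn_add2r dimv_eq0 capfv => /eqP ker0.
have : y \in lker (linfun h) by rewrite memv_ker hE xy.
by rewrite ker0 memv0 (negPf y0).
Qed.

Lemma mcoeff_linear (F : fieldType) (A : invAlg F) (a b : A) (k : nat) :
  (<< a *g 1%N >> - << b *g 0%N >> : apoly A)@_k
    = (if k == 1%N then a else 0) - (if k == 0%N then b else 0).
Proof.
by rewrite mcoeffB !mcoeffU ![_ == k]eq_sym; do 2!case: (k == _).
Qed.

Lemma apeval_linear (F : fieldType) (A : invAlg F) (a b q : A) :
  apeval (<< a *g 1%N >> - << b *g 0%N >> : apoly A) q = a ** q - b.
Proof.
set f := (X in apeval X q).
(* The support is smaller than [{0, 1}] when [a] or [b] vanishes; the sum is enlarged to both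
   indices by zero terms. *)
have sub : {subset msupp f <= [fset 0%N; 1%N]%fset}.
  move=> k; rewrite -mcoeff_neq0 mcoeff_linear !inE.
  by case: (k == 1%N); case: (k == 0%N); rewrite ?orbT // subrr eqxx.
rewrite /apeval (@big_fset_incl _ _ _ _ _ [fset 0%N; 1%N]%fset).
- rewrite big_fsetU1 ?inE //= big_seq_fset1 !mcoeff_linear /= /apow /=.
  by rewrite !amul1r sub0r subr0 addrC.
- exact/fsubsetP.
- by move=> k _ /mcoeff_outdom ->; rewrite amul0l.
Qed.

Lemma apdeg_linear (F : fieldType) (A : invAlg F) (a b : A) :
  a != 0 -> (0 < apdeg (<< a *g 1%N >> - << b *g 0%N >> : apoly A)%R)%N.
Proof.
move=> a0; rewrite /apdeg; set f := (X in msupp X).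
have in1 : 1%N \in msupp f by rewrite -mcoeff_neq0 mcoeff_linear subr0.
by rewrite (big_fsetD1 1%N) //= leq_max.
Qed.

Theorem mainTheorem2 (R : realType) (A : invAlg R)
    (cdA : cayley_dickson A) (anisoA : anisotropic A)
    (dimA : (16 <= \dim {:A})%N) :
  ~ algebraically_closed A /\
  exists alpha beta : A, alpha != 0 /\
    ~ exists lambda : A,
        aproot (<< alpha *g 1%N >> - << beta *g 0%N >> : apoly A) lambda.
Proof.
have [_ _ _ /(_ dimA) [a [y [a0 y0 ay]]]] := cayley_dickson_units cdA anisoA.
have [b nb] := zero_divisor_not_surjective y0 ay.
have noroot q : ~ aproot (<< a *g 1%N >> - << b *g 0%N >> : apoly A) q.
  by rewrite /aproot apeval_linear => /eqP; rewrite subr_eq0 (negPf (nb q)).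
(* The same polynomial, of positive degree, refutes algebraic closedness. *)
split; last by exists a, b; split=> // -[q /noroot].
by move=> /(_ _ (apdeg_linear b a0)) [q /noroot].
Qed.
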